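(* Let $\lambda$ be a nonzero real number and let $F_{n,\lambda}(x)$ ($n\ge 0$) be the degenerate Fubini polynomials. Then for every integer $n\ge 1$, $$\sum_{k=1}^{n}\binom{n}{k-1}(1-\lambda)_{n-k,\lambda}F_{k,\lambda}(x)=\sum_{k=0}^{n}\binom{n}{k}(1-\lambda)_{n-k,\lambda}\,xF_{k,\lambda}^{\prime}(x),$$ where $F_{k,\lambda}^{\prime}(x)=\frac{d}{dx}F_{k,\lambda}(x)$.
   Context: For a nonzero real number $\lambda$: generalized falling factorials $(x)_{0,\lambda}=1$, $(x)_{n,\lambda}=x(x-\lambda)\cdots(x-(n-1)\lambda)$ for $n\ge 1$. With $(x)_0=1$ and $(x)_n=x(x-1)\cdots(x-n+1)$ for $n\ge 1$, the degenerate Stirling numbers of the second kind ${n \brace k}_{\lambda}$ ($0\le k\le n$) are defined by the polynomial identity $(x)_{n,\lambda}=\sum_{k=0}^{n}{n \brace k}_{\lambda}(x)_{k}$, $n\ge 0$. The degenerate Fubini polynomials are $F_{n,\lambda}(x)=\sum_{k=0}^{n}{n \brace k}_{\lambda}k!\,x^{k}$. *)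

(* Defs.v *)
From HB Require Import structures.
From mathcomp Require Import all_boot all_order all_algebra.
From mathcomp Require Import reals.

Set Implicit Arguments.
Unset Strict Implicit.
Unset Printing Implicit Defensive.

Import GRing.Theory.
Local Open Scope ring_scope.

(* (a)_{n,lambda} = a (a - lambda) ... (a - (n-1) lambda). It is used with
   [A] the field of coefficients and with [A] the polynomial ring; the
   ordinary falling factorial (a)_n is the case [lambda = 1]. *)
Definition gffact (A : comNzRingType) (lambda a : A) (n : nat) : A :=
  \prod_(i < n) (a - lambda *+ i).

Section DegenerateFubini.
Variable R : realType.
Implicit Types (lambda : R) (p : {poly R}).

(* \sum_(k <= n) c_k (x)_k, as a polynomial in x. *)
Definition ffact_comb n (c : {ffun 'I_n.+1 -> R}) : {poly R} :=
  \sum_(k < n.+1) c k *: gffact 1 'X k.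

Lemma gffactXE n :
  gffact 1 'X n = \prod_(i < n) ('X - (i%:R)%:P) :> {poly R}.
Proof. by apply: eq_bigr => i _; rewrite rmorph_nat. Qed.

Lemma monic_gffactX n : gffact 1 ('X : {poly R}) n \is monic.
Proof. by rewrite gffactXE; apply: monic_prod => i _; apply: monicXsubC. Qed.

Lemma size_gffactX n : size (gffact 1 ('X : {poly R}) n) = n.+1.
Proof.
rewrite gffactXE -(big_mkord xpredT (fun i => 'X - (i%:R)%:P)).
by rewrite size_prod_XsubC size_iota subn0.
Qed.

Lemma size_gffactX_lambda lambda n :
  size (gffact lambda%:P 'X n : {poly R}) = n.+1.
Proof.
have -> : gffact lambda%:P 'X n = \prod_(i < n) ('X - (lambda *+ i)%:P).
  by apply: eq_bigr => i _; rewrite rmorphMn.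
rewrite -(big_mkord xpredT (fun i => 'X - (lambda *+ i)%:P)).
by rewrite size_prod_XsubC size_iota subn0.
Qed.

Lemma ffact_comb_surj n p :
  (size p <= n.+1)%N -> exists c, p == @ffact_comb n c.
Proof.
elim: n p => [|n IHn] p sp.
  exists [ffun=> p`_0]; rewrite /ffact_comb big_ord1 ffunE /gffact big_ord0.
  by rewrite alg_polyC -size1_polyC.
set q := p - p`_n.+1 *: gffact 1 'X n.+1.
have sq : (size q <= n.+1)%N.
  apply/leq_sizeP => j; rewrite leq_eqVlt => /predU1P[<-|lt_nj].
    rewrite coefB coefZ.
    have /monicP := monic_gffactX n.+1.
    by rewrite lead_coefE size_gffactX /= => ->; rewrite mulr1 subrr.
  rewrite coefB coefZ (nth_default _ (leq_trans sp lt_nj)).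
  by rewrite [X in _ * X]nth_default ?size_gffactX // mulr0 subr0.
have [c /eqP qE] := IHn q sq.
exists [ffun k => if unlift ord_max k is Some j then c j else p`_n.+1].
rewrite /ffact_comb big_ord_recr /= ffunE unlift_none -subr_eq; apply/eqP.
rewrite -/q qE /ffact_comb; apply: eq_bigr => i _; rewrite ffunE.
suff -> : widen_ord (leqnSn n.+1) i = lift ord_max i by rewrite liftK.
  exact/val_inj/esym/lift_max.
Qed.

Lemma ffact_comb_inj n : injective (@ffact_comb n).
Proof.
move=> c d eq_cd; apply/ffunP => k; apply/eqP; rewrite -subr_eq0.
pose e i := c i - d i; rewrite -/(e k).
have: \sum_(i < n.+1) e i *: gffact 1 ('X : {poly R}) i = 0.
  rewrite /e; under eq_bigr do rewrite scalerBl.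
  by rewrite sumrB; apply/eqP; rewrite subr_eq0; apply/eqP.
move: e => {c d eq_cd}e; move: n.+1 k e.
elim=> [|m IHm] k e e0; first by case: k.
have em0 : e ord_max = 0.
  have := congr1 (fun p => p`_m) e0; rewrite big_ord_recr /= coefD coefZ.
  have /monicP := monic_gffactX m.
  rewrite lead_coefE size_gffactX /= => ->; rewrite mulr1 coef_sum coef0.
  rewrite big1 ?add0r // => i _.
  by rewrite coefZ nth_default ?mulr0 // size_gffactX.
move: e0; rewrite big_ord_recr /= em0 scale0r addr0 => e0.
case: (unliftP ord_max k) => [j|] ->; last by rewrite em0.
have := IHm j (fun i => e (widen_ord (leqnSn m) i)) e0.
suff -> : widen_ord (leqnSn m) j = lift ord_max j by [].
  exact/val_inj/esym/lift_max.
Qed.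

Lemma degStirling2_subproof lambda n :
  exists c, gffact lambda%:P 'X n == @ffact_comb n c.
Proof. by apply: ffact_comb_surj; rewrite size_gffactX_lambda. Qed.

(* The coefficients in (x)_{n,lambda} = \sum_(k <= n) {n,k}_lambda (x)_k;
   they are unique by [ffact_comb_inj]. *)
Definition degStirling2 lambda n : {ffun 'I_n.+1 -> R} :=
  xchoose (degStirling2_subproof lambda n).

Lemma degStirling2P lambda n :
  gffact lambda%:P 'X n =
  \sum_(k < n.+1) degStirling2 lambda n k *: gffact 1 'X k :> {poly R}.
Proof. exact/eqP/(xchooseP (degStirling2_subproof lambda n)). Qed.

Definition degFubini lambda n : {poly R} :=
  \sum_(k < n.+1) (degStirling2 lambda n k * (k`!)%:R) *: 'X^k.

End DegenerateFubini.

(* Main.v *)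
Require Import Defs.
From HB Require Import structures.
From mathcomp Require Import all_boot all_order all_algebra.
From mathcomp Require Import reals.
From mathcomp Require Import ring.

Set Implicit Arguments.
Unset Strict Implicit.
Unset Printing Implicit Defensive.

Import GRing.Theory.
Local Open Scope ring_scope.

(** The proof is umbral. Let [L] be the linear operator on polynomials that
sends [(y)_k] to [k! x^k]; by the definition of the degenerate Stirling
numbers, [F_{k,lambda} = L (y)_{k,lambda}]. By Newton's interpolation formula,
the coefficient of [x^k] in [L p] is the [k]-th forward difference of [p] at
[0], and the Leibniz rule [Delta^k (y h) = y Delta^k h + k Delta^(k-1) h(y+1)]
evaluated at [y = 0] gives, for every polynomial [g],
[[
  L (y (g(y+1) - g(y))) = x (L (g(y+1)))'            (lemma newton_mulX_fdiff)
]]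
The theorem is the case [g = (y - lambda)_{n,lambda}]. Indeed the
Chu-Vandermonde formula [gffactD] gives
[(y + 1 - lambda)_{n,lambda} =
  \sum_k 'C(n, k) (1 - lambda)_{n-k,lambda} (y)_{k,lambda}], so that the right
member is [x (L (g(y+1)))']. Splitting [y + 1 - lambda] as
[1 + (y - lambda)] instead and using
[(1)_{m+1,lambda} = (1 - lambda)_{m,lambda}] and
[y (y - lambda)_{k,lambda} = (y)_{k+1,lambda}], the left member is
[L (y (g(y+1) - g(y)))]; the missing term [k = n] of the Chu-Vandermonde
sum is [g(y)]. *)

Section GeneralizedFallingFactorial.
Variable A : comNzRingType.
Implicit Types a b l : A.

Lemma gffact0 l a : gffact l a 0 = 1.
Proof. by rewrite /gffact big_ord0. Qed.

Lemma gffactSr l a n : gffact l a n.+1 = gffact l a n * (a - l *+ n).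
Proof. by rewrite /gffact big_ord_recr. Qed.

Lemma gffactS l a n : gffact l a n.+1 = a * gffact l (a - l) n.
Proof.
rewrite /gffact big_ord_recl /= mulr0n subr0; congr (_ * _).
by apply: eq_bigr => i _; rewrite /bump /= add1n mulrS opprD addrA.
Qed.

Lemma rmorph_gffact (B : comNzRingType) (f : {rmorphism A -> B}) l a n :
  f (gffact l a n) = gffact (f l) (f a) n.
Proof.
by rewrite rmorph_prod; apply: eq_bigr => i _; rewrite rmorphB rmorphMn.
Qed.

(** The Chu-Vandermonde formula. *)
Lemma gffactD l a b n :
  gffact l (a + b) n =
  \sum_(k < n.+1) 'C(n, k)%:R * gffact l a (n - k) * gffact l b k.
Proof.
elim: n => [|n IHn].
  by rewrite big_ord1 bin0 !gffact0 !mulr1.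
(* Multiplication by a + b - l n, distributed over the sum as
   (a - l (n - k)) + (b - l k), raises the index of either factor. *)
have -> : gffact l (a + b) n.+1 =
    \sum_(k < n.+1) 'C(n, k)%:R * gffact l a (n.+1 - k) * gffact l b k +
    \sum_(k < n.+1) 'C(n, k)%:R * gffact l a (n - k) * gffact l b k.+1.
  rewrite gffactSr IHn mulr_suml -big_split /=; apply: eq_bigr => k _.
  have le_kn : (k <= n)%N by rewrite -ltnS.
  rewrite subSn // !gffactSr -[in l *+ n](subnK le_kn) mulrnDr.
  ring.
rewrite [RHS]big_ord_recl [X in X + _]big_ord_recl /= !bin0 -addrA.
congr (_ + _).
under [RHS]eq_bigr do rewrite /bump /= add1n binS natrD !mulrDl subSS.
rewrite big_split /= [in RHS]big_ord_recr /= bin_small // !mul0r addr0.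
by congr (_ + _); apply: eq_bigr => k _; rewrite /bump /= add1n subSS.
Qed.

End GeneralizedFallingFactorial.

Section ForwardDifference.
Variable A : comNzRingType.
Implicit Types (p q : {poly A}) (k n N : nat).

(** The forward difference [p(y + 1) - p(y)]. *)
Definition fdiff p : {poly A} := p \Po ('X + 1) - p.

Fact fdiff_is_linear : linear fdiff.
Proof.
move=> a p q; rewrite /fdiff linearP /= scalerBr opprD.
by rewrite addrACA.
Qed.
#[warning="-redundant-canonical-projection"]
HB.instance Definition _ :=
  GRing.isLinear.Build A {poly A} {poly A} _ fdiff fdiff_is_linear.

Lemma iter_fdiff_is_linear k : linear (iter k fdiff).
Proof. by elim: k => [|k IHk] a p q //; rewrite !iterS IHk linearP. Qed.
#[warning="-redundant-canonical-projection"]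
HB.instance Definition _ k :=
  GRing.isLinear.Build A {poly A} {poly A} _ (iter k fdiff)
    (iter_fdiff_is_linear k).

Lemma fdiff_mulX p : fdiff ('X * p) = 'X * fdiff p + (p \Po ('X + 1)).
Proof. by rewrite /fdiff comp_polyM comp_polyX; ring. Qed.

Lemma iter_fdiff_shift k p :
  iter k fdiff (p \Po ('X + 1)) = iter k fdiff p \Po ('X + 1).
Proof. by elim: k => //= k ->; rewrite [in RHS]/fdiff linearB. Qed.

(** The Leibniz rule for iterated differences, when one factor is the
variable. *)
Lemma iter_fdiff_mulX k p :
  iter k.+1 fdiff ('X * p) =
  'X * iter k.+1 fdiff p + (iter k fdiff p \Po ('X + 1)) *+ k.+1.
Proof.
elim: k => [|k IHk]; first exact: fdiff_mulX.
rewrite iterS IHk linearD linearMn /= fdiff_mulX.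
by rewrite -[fdiff (_ \Po _)]/(iter 1 fdiff _) iter_fdiff_shift -addrA -mulrS.
Qed.

Lemma fdiff_gffactX n :
  fdiff (gffact 1 'X n.+1) = gffact 1 'X n *+ n.+1 :> {poly A}.
Proof.
rewrite /fdiff (rmorph_gffact (comp_poly ('X + 1))) /= comp_polyX.
rewrite comp_polyC gffactS addrK gffactSr -mulr_natr.
by rewrite -[_ *+ n.+1]mulr_natr -natr1; ring.
Qed.

Lemma iter_fdiff_gffactX0 k n :
  (iter k fdiff (gffact 1 'X n)).[0] = (n`! * (k == n))%:R.
Proof.
elim: k n => [|k IHk] [|n]; rewrite ?gffact0.
- by rewrite hornerC.
- by rewrite gffactS hornerM hornerX mul0r muln0.
- by rewrite iterSr /fdiff comp_polyC subrr linear0 horner0 muln0.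
rewrite iterSr fdiff_gffactX linearMn.
by rewrite hornerMn IHk eqSS -mulrnA factS mulnC mulnA.
Qed.

(** The linear operator that sends [(y)_k] to [k! x^k] for [k < N], see
[newton_gffactX]. It is given by the forward differences at [0]; truncating at
[N] makes it linear by construction, and is harmless on polynomials of degree
less than [N]. *)
Definition newton N p : {poly A} :=
  \poly_(k < N) (iter k fdiff p).[0].

Fact newton_is_linear N : linear (newton N).
Proof.
move=> a p q; apply/polyP => k; rewrite coefD coefZ !coef_poly.
case: ifP => _; last by rewrite mulr0 addr0.
by rewrite iter_fdiff_is_linear hornerD hornerZ.
Qed.
#[warning="-redundant-canonical-projection"]
HB.instance Definition _ N :=
  GRing.isLinear.Build A {poly A} {poly A} _ (newton N) (newton_is_linear N).

Lemma newton_gffactX N n : (n < N)%N ->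
  newton N (gffact 1 'X n) = (n`!)%:R *: 'X^n.
Proof.
move=> lt_nN; apply/polyP => k; rewrite coef_poly coefZ coefXn.
rewrite iter_fdiff_gffactX0 natrM.
by have [->|ne_kn] := eqVneq k n; rewrite ?lt_nN // mulr0 if_same.
Qed.

Lemma newton_mulX_fdiff N p :
  newton N ('X * fdiff p) = 'X * (newton N (p \Po ('X + 1)))^`().
Proof.
apply/polyP => -[|k]; rewrite coefXM coef_poly /=.
  by rewrite hornerM hornerX mul0r if_same.
rewrite coef_deriv coef_poly; case: ifP => _; last by rewrite mul0rn.
rewrite -iterS iter_fdiff_mulX hornerD hornerM hornerX mul0r add0r hornerMn.
by rewrite -iterSr iter_fdiff_shift.
Qed.

End ForwardDifference.

Lemma degFubiniE (R : realType) (lambda : R) N n : (n < N)%N ->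
  degFubini lambda n = newton N (gffact lambda%:P 'X n).
Proof.
move=> lt_nN; rewrite degStirling2P linear_sum /=; apply: eq_bigr => k _.
by rewrite linearZ /= newton_gffactX ?scalerA // (leq_trans (ltn_ord k)).
Qed.

Theorem theorem2p15 (R : realType) (lambda : R) (lambda_neq0 : lambda != 0)
    (n : nat) (n_ge1 : (1 <= n)%N) :
  \sum_(1 <= k < n.+1)
     ('C(n, k.-1)%:R * gffact lambda (1 - lambda) (n - k)) *:
       degFubini lambda k
  = \sum_(0 <= k < n.+1)
     ('C(n, k)%:R * gffact lambda (1 - lambda) (n - k)) *:
       ('X * (degFubini lambda k)^`()).
Proof.
pose g : {poly R} := gffact lambda%:P ('X - lambda%:P) n.
have gS : g \Po ('X + 1) = gffact lambda%:P ((1 - lambda)%:P + 'X) n.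
  rewrite (rmorph_gffact (comp_poly ('X + 1))) /= comp_polyC linearB /=.
  by rewrite comp_polyX comp_polyC polyCB; congr gffact; ring.
transitivity (newton n.+1 ('X * fdiff g)).
  have -> : 'X * fdiff g = \sum_(k < n)
      ('C(n, k)%:R * gffact lambda (1 - lambda) (n - k.+1)) *:
        gffact lambda%:P 'X k.+1.
    (* Regroup (1 - lambda) + y as 1 + (y - lambda). *)
    rewrite /fdiff gS polyCB addrAC -addrA gffactD big_ord_recr /=.
    rewrite binn subnn gffact0 !mul1r addrK mulr_sumr; apply: eq_bigr => k _.
    (* n - k > 0, so the leading factor 1 of (1)_{n-k,lambda} splits off. *)
    rewrite -[(n - k)%N]prednK ?subn_gt0 // -subnS !gffactS mul1r.
    rewrite -mul_polyC polyCM (rmorph_gffact polyC) /= polyCB polyC_natr.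
    ring.
  rewrite big_add1 big_mkord linear_sum; apply: eq_bigr => k _ /=.
  by rewrite linearZ /= -degFubiniE // ltnS.
rewrite newton_mulX_fdiff gS gffactD linear_sum raddf_sum mulr_sumr big_mkord.
apply: eq_bigr => k _ /=.
rewrite -(rmorph_gffact polyC) -(rmorph_nat polyC) -polyCM mul_polyC.
by rewrite linearZ /= -degFubiniE // derivZ scalerAr.
Qed.
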